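(* Let $S\subset\mathbb{R}^2$ be a set of points in general position with $|S|=n\ge 3$, and assume that $n$ is odd. Then the number of cells in the even order Voronoi diagrams of $S$ equals the number of cells in the odd order Voronoi diagrams of $S$; that is, $$\sum_{\substack{0\le k\le n\\ k \text{ even}}} f_k \;=\; \sum_{\substack{0\le k\le n\\ k\text{ odd}}} f_k .$$
   Context: A finite set $S$ of distinct points in $\mathbb{R}^2$ is in general position if no three points of $S$ are collinear and no four points of $S$ are cocircular. For $A\subset S$, the Voronoi cell of $A$ (of order $|A|$) is $V(A)=\bigcap_{x\in A,\,y\in S\setminus A}\{p\in\mathbb{R}^2 : d(x,p)\le d(y,p)\}$, where $d$ is Euclidean distance. For $1\le k\le n$, the $k$-th order Voronoi diagram is the collection $V_k(S)$ of the non-empty cells $V(A)$ with $A\subset S$, $|A|=k$, and $f_k$ denotes the number of subsets $A\subset S$ with $|A|=k$ and $V(A)\neq\emptyset$. By convention the order-zero diagram consists of one cell, corresponding to the empty set, so $f_0=1$ (this cell counts as an even order cell). Also $f_n=1$. *)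

(* Defs.v *)
From mathcomp Require Import all_boot all_order all_algebra.
From mathcomp Require Import finmap.
From mathcomp Require Import boolp classical_sets reals.

Set Implicit Arguments.
Unset Strict Implicit.
Unset Printing Implicit Defensive.

Import Order.TTheory GRing.Theory Num.Theory.

Local Open Scope fset_scope.
Local Open Scope ring_scope.
Local Open Scope classical_set_scope.

Section HigherOrderVoronoi.
Variable R : realType.

(* The norm that MathComp-Analysis puts on 'rV[R]_2 is the sup norm, so it
   cannot be used for the distance. *)
Definition eucl_dist (p q : 'rV[R]_2) : R :=
  Num.sqrt (\sum_(i < 2) (p 0 i - q 0 i) ^+ 2).

Definition collinear (T : {fset 'rV[R]_2}) : Prop :=
  exists a b c : R, (a, b) <> (0, 0) /\
    forall p, p \in T -> a * p 0 0 + b * p 0 1 = c.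

Definition cocircular (T : {fset 'rV[R]_2}) : Prop :=
  exists (o : 'rV[R]_2) (r : R), 0 < r /\
    forall p, p \in T -> eucl_dist o p = r.

Definition general_position (S : {fset 'rV[R]_2}) : Prop :=
  (forall T, (T `<=` S)%fset -> #|` T| = 3%N -> ~ collinear T) /\
  (forall T, (T `<=` S)%fset -> #|` T| = 4%N -> ~ cocircular T).

Definition voronoi_cell (S A : {fset 'rV[R]_2}) : set 'rV[R]_2 :=
  \bigcap_(x in [set` A]) \bigcap_(y in [set` (S `\` A)%fset])
    [set p | eucl_dist x p <= eucl_dist y p].

(* For A = fset0 and for A = S the intersection is over an empty family, so
   the cell is the whole plane: this gives f_0 = f_n = 1. *)
Definition num_voronoi_cells (S : {fset 'rV[R]_2}) (k : nat) : nat :=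
  #|` [fset A in fpowerset S | (#|` A| == k) && `[< voronoi_cell S A !=set0 >]]%fset|.

End HigherOrderVoronoi.

(* Main.v *)
(* For a closed cell V(A) write 1_V(A) for its indicator. At a point p the sets A
   with p in V(A) are, for the order by distance to p, the initial segments up to
   ties; since n is odd and at most three points are at equal distance from p,
     sum_A (-1)^|A| 1_V(A)(p) = - sum_({x,y}, P) (-1)^|P| 1_J({x,y},P)(p),
   where J({x,y},P) is the part of the bisector of x and y on which the points of
   P are at most as far as x, and the remaining points at least as far.
   All these sets are closed polyhedra, so Euler's relation allows every
   indicator to be replaced by 1 or 0 according to whether the set is nonempty.
   The right-hand side then vanishes for each pair {x,y} separately: the n - 2
   other points cut the bisector at distinct places into n - 1 pieces of
   alternating sign, and n - 1 is even. *)
Require Import Defs.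
From mathcomp Require Import boolp classical_sets reals finmap.
From mathcomp Require Import all_boot all_order all_algebra.
From mathcomp Require Import lra ring.

Set Implicit Arguments.
Unset Strict Implicit.
Unset Printing Implicit Defensive.

Import Order.TTheory GRing.Theory Num.Theory.

Local Open Scope ring_scope.

(** * Euler's relation for closed polyhedra on the line and in the plane *)

Lemma sum_cond_natr (A : nzRingType) (I : finType) (P : pred I) (F : I -> A) :
  \sum_(i | P i) F i = \sum_i F i * (P i)%:R.
Proof.
by rewrite big_mkcond; apply: eq_bigr => i _; case: (P i); rewrite ?mulr1 ?mulr0.
Qed.

Section EulerRelation.
Variable R : realFieldType.
Implicit Types (s : seq (R * R)) (q : seq (R * R * R)).

Definition halflines s (t : R) : bool := all (fun c => c.1 * t <= c.2) s.

Definition halfplanes q (x y : R) : bool :=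
  all (fun c => c.1.1 * x + c.1.2 * y <= c.2) q.

(* Vertices minus edges of the trace of K on the subdivision with vertices
   e :: l; an edge is tested at its midpoint. *)
Fixpoint alt_count (K : R -> bool) e l : int :=
  if l is e' :: l' then (K e)%:R - (K ((e + e') / 2))%:R + alt_count K e' l'
  else (K e)%:R.

Lemma alt_count_sum (I : finType) (c : I -> int) (K : I -> R -> bool) e l :
  (forall t, \sum_i c i * (K i t)%:R = 0) -> \sum_i c i * alt_count (K i) e l = 0.
Proof.
move=> c0; elim: l e => [|e' l IH] e; first by rewrite -[RHS](c0 e).
under eq_bigr do rewrite [alt_count _ _ _]/= mulrDr mulrBr.
by rewrite !big_split /= sumrN !c0 IH.
Qed.

(** The second hypothesis says that if [K] meets an open gap between consecutive vertices, then it
    contains both ends of that gap. So an edge counts exactly when both its ends do. By convexity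
    the vertices in [K] form one consecutive run, which has one edge fewer than vertices unless it
    is empty. *)
Lemma alt_count_has (K : R -> bool) e l :
  (forall a t b, a <= t -> t <= b -> K a -> K b -> K t) ->
  (forall a b t, a \in e :: l -> b \in e :: l -> a < t < b ->
     {in e :: l, forall x, x <= a \/ b <= x} -> K t -> K a && K b) ->
  path <%R e l -> alt_count K e l = (has K (e :: l))%:R.
Proof.
move=> Kconv; elim: l e => [|e' l IH] e gap //=; first by rewrite orbF.
case/andP=> lee' pl.
have le_e' x : x \in e' :: l -> e' <= x.
  rewrite inE => /orP[/eqP->//|xl].
  by have /allP /(_ x xl) := order_path_min lt_trans pl; exact: ltW.
have -> : K ((e + e') / 2) = K e && K e'.
  apply/idP/andP => [Km|[Ke Ke']]; last by apply: Kconv Ke Ke'; lra.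
  apply/andP; apply: (gap _ _ _ _ _ _ _ Km); rewrite ?inE ?eqxx ?orbT //; first lra.
  by move=> x; rewrite inE => /orP[/eqP->|/le_e']; [left|right].
rewrite IH //=; last first.
  move=> a b t aE bE /andP[lat ltb] nox Kt.
  apply: (gap _ _ t); rewrite ?lat //; [by rewrite inE aE orbT|by rewrite inE bE orbT|].
  move=> x; rewrite inE => /orP[/eqP->|]; last exact: nox.
  by left; apply: (le_trans (ltW lee')); exact: le_e'.
case Ke: (K e) => /=; last by rewrite subrr add0r.
case Ke': (K e') => /=; first by rewrite subrr add0r.
rewrite subr0; case: hasP => [[x xl Kx]|]; last by rewrite addr0.
by rewrite (Kconv e e' x) ?(ltW lee') ?le_e' ?inE ?xl ?orbT in Ke'.
Qed.

Lemma halflines_convex s a t b :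
  a <= t -> t <= b -> halflines s a -> halflines s b -> halflines s t.
Proof.
move=> lat ltb /allP Ka /allP Kb; apply/allP => c cs.
have /= := Ka c cs; have /= := Kb c cs.
have [c0|c0] := leP 0 c.1 => ? ?.
  by apply: le_trans (ler_wpM2l c0 ltb) _.
by apply: le_trans (ler_wnM2l (ltW c0) lat) _.
Qed.

(** On the way to the right only constraints with [c.1 > 0] can fail, and they do so at the endpoint
    [c.2 / c.1]. The hypothesis keeps such endpoints out of the stretch from [t] up to [u]. *)
Lemma halflines_right s t u : t <= u ->
  (forall c, c \in s -> t <= c.2 / c.1 -> u <= c.2 / c.1) ->
  halflines s t -> halflines s u.
Proof.
move=> tu H /allP Kt; apply/allP => c cs; have /= := Kt c cs.
case: (ltgtP c.1 0) => [c0|c0|->]; last by rewrite !mul0r.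
  by apply: le_trans; rewrite ler_wnM2l // ltW.
by have := H c cs; rewrite !ler_pdivlMr // ![_ * c.1]mulrC.
Qed.

Lemma halflines_left s t u : u <= t ->
  (forall c, c \in s -> c.2 / c.1 <= t -> c.2 / c.1 <= u) ->
  halflines s t -> halflines s u.
Proof.
move=> tu H /allP Kt; apply/allP => c cs; have /= := Kt c cs.
case: (ltgtP c.1 0) => [c0|c0|->]; last by rewrite !mul0r.
  by have := H c cs; rewrite !ler_ndivrMr // ![_ * c.1]mulrC.
by apply: le_trans; rewrite ler_wpM2l // ltW.
Qed.

(* Evaluating alt_count on the sorted list of all endpoints turns nonemptiness
   into a fixed linear combination of point evaluations. *)
Lemma euler_relation1 (I : finType) (c : I -> int) (s : I -> seq (R * R)) :
  (forall t, \sum_(i | halflines (s i) t) c i = 0) ->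
  \sum_(i | `[< exists t, halflines (s i) t >]) c i = 0.
Proof.
move=> c0.
(* The extra 0 makes the list of vertices nonempty, as [alt_count] requires a first vertex. *)
pose E0 := 0 :: flatten [seq [seq x.2 / x.1 | x <- s i] | i <- enum I].
pose E : seq R := sort <=%R (undup E0).
have Elt : sorted <%R E by rewrite sort_lt_sorted undup_uniq.
have memE i x : x \in s i -> x.2 / x.1 \in E.
  move=> xs; rewrite mem_sort mem_undup inE; apply/orP; right.
  by apply/flatten_mapP; exists i; rewrite ?mem_enum //; apply: map_f.
have E00 : 0 \in E by rewrite mem_sort mem_undup inE eqxx.
case defE: E E00 => [|e l] // _.
have pE : path <%R e l by move: Elt; rewrite defE.
rewrite sum_cond_natr -[RHS](@alt_count_sum I c (fun i => halflines (s i)) e l); last first.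
  by move=> t; rewrite -sum_cond_natr.
apply: eq_bigr => i _; congr (_ * _); rewrite alt_count_has //; first last.
- move=> a b t _ _ /andP[lat ltb] gap Kt; apply/andP; split.
    apply: halflines_left Kt; first exact: ltW.
    move=> x /memE; rewrite defE => /gap[//|bx] xt.
    by have := le_lt_trans (le_trans bx xt) ltb; rewrite ltxx.
  apply: halflines_right Kt; first exact: ltW.
  move=> x /memE; rewrite defE => /gap[xa|//] xt.
  by have := lt_le_trans lat (le_trans xt xa); rewrite ltxx.
- exact: halflines_convex.
(* A nonempty [K] contains a vertex: a point [t] of [K] can be moved right to the next vertex, or
   left to the last one if no vertex is at or beyond [t]. *)
congr (nat_of_bool _)%:R; apply/asboolP/hasP => [[t Kt]|[x _ Kx]]; last by exists x.
have El : sorted <=%R (e :: l) by exact: (sub_sorted (@ltW _ R)).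
case defF: [seq x <- e :: l | t <= x] => [|u F].
  have lt_t x : x \in e :: l -> x < t.
    move=> xl; rewrite ltNge; apply/negP => tx.
    by have := mem_filter (fun x => t <= x) x (e :: l); rewrite defF in_nil tx xl.
  exists (last e l); first exact: mem_last.
  apply: halflines_left Kt; first by rewrite ltW // lt_t // mem_last.
  move=> x /memE; rewrite defE => xl _.
  have : sorted >=%R (rev (e :: l)) by rewrite rev_sorted.
  rewrite lastI rev_rcons /= => /(order_path_min ge_trans)/allP H.
  move: xl; rewrite lastI mem_rcons inE => /orP[/eqP->//|xl].
  by apply: H; rewrite mem_rev.
have : u \in [seq x <- e :: l | t <= x] by rewrite defF inE eqxx.
rewrite mem_filter => /andP[tu ul]; exists u => //.
apply: halflines_right Kt => // x /memE; rewrite defE => xl tx.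
have : x.2 / x.1 \in u :: F by rewrite -defF mem_filter tx.
rewrite inE => /orP[/eqP->//|xF].
have : sorted <=%R (u :: F) by rewrite -defF; apply: sorted_filter => //; exact: le_trans.
by move=> /(order_path_min le_trans)/allP /(_ _ xF).
Qed.

Lemma exists_between (L U : seq R) :
  (forall l u, l \in L -> u \in U -> l <= u) ->
  exists y, (forall l, l \in L -> l <= y) /\ (forall u, u \in U -> y <= u).
Proof.
elim: L => [|l L IH] LU.
  elim: U {LU} => [|u U [y [_ yU]]]; first by exists 0.
  exists (Num.min u y); split=> // v; rewrite inE => /orP[/eqP->|/yU yv].
    by rewrite ge_min lexx.
  by rewrite ge_min yv orbT.
have [|y [Ly yU]] := IH; first by move=> l' u l'L; apply: LU; rewrite inE l'L orbT.
exists (Num.max l y); split=> [v|u uU].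
  by rewrite inE => /orP[/eqP->|/Ly vy]; rewrite le_max ?lexx ?vy ?orbT.
by rewrite ge_max LU ?inE ?eqxx ?yU.
Qed.

(* Fourier-Motzkin elimination. *)
Definition eliminate q : seq (R * R) :=
  [seq (c.1.1, c.2) | c <- q & c.1.2 == 0] ++
  [seq (c.1.1 / c.1.2 - d.1.1 / d.1.2, c.2 / c.1.2 - d.2 / d.1.2)
     | c <- [seq c <- q | 0 < c.1.2], d <- [seq d <- q | d.1.2 < 0]].

Lemma eliminateP q x :
  halflines (eliminate q) x = `[< exists y, halfplanes q x y >].
Proof.
(* [v c] is the bound that [c] puts on the second coordinate above [x]: an upper bound if
   [c.1.2 > 0], a lower one if [c.1.2 < 0]. *)
pose v (c : R * R * R) := (c.2 - c.1.1 * x) / c.1.2.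
have vE (c d : R * R * R) : (v d <= v c) =
    ((c.1.1 / c.1.2 - d.1.1 / d.1.2) * x <= c.2 / c.1.2 - d.2 / d.1.2).
  rewrite /v -[LHS]subr_ge0 -[RHS]subr_ge0; congr (0 <= _); ring.
have vpos (c : R * R * R) y : 0 < c.1.2 -> (c.1.1 * x + c.1.2 * y <= c.2) = (y <= v c).
  by move=> c0; rewrite ler_pdivlMr // lerBrDl mulrC [y * _]mulrC [x * _]mulrC.
have vneg (c : R * R * R) y : c.1.2 < 0 -> (c.1.1 * x + c.1.2 * y <= c.2) = (v c <= y).
  by move=> c0; rewrite ler_ndivrMr // lerBrDl mulrC [y * _]mulrC [x * _]mulrC.
rewrite /halflines all_cat; apply/andP/asboolP => [[/allP H0 /allP H1]|[y /allP H]].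
  have [|y [Ly yU]] := @exists_between
      [seq v d | d <- q & d.1.2 < 0] [seq v c | c <- q & 0 < c.1.2].
    move=> _ _ /mapP[d dq ->] /mapP[c cq ->]; rewrite vE.
    by have := H1 _ (allpairs_f (fun c d =>
      (c.1.1 / c.1.2 - d.1.1 / d.1.2, c.2 / c.1.2 - d.2 / d.1.2)) cq dq).
  exists y; apply/allP => c cq; case: (ltgtP c.1.2 0) => c0.
  - by rewrite vneg // Ly // map_f // mem_filter c0.
  - by rewrite vpos // yU // map_f // mem_filter c0.
  - rewrite c0 mul0r addr0.
    by apply: (H0 (c.1.1, c.2)); apply/mapP; exists c; rewrite // mem_filter c0 eqxx.
split; last first.
  apply/allP => _ /allpairsP[[c d] /= [+ + ->]] /=.
  rewrite !mem_filter => /andP[c0 /H] + /andP[d0 /H].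
  by rewrite vpos // vneg // -vE => yc dy; exact: le_trans dy yc.
apply/allP => _ /mapP[c + ->]; rewrite mem_filter => /andP[/eqP c0 /H].
by rewrite c0 mul0r addr0.
Qed.

(** The relation on the line is used twice: on each vertical line, which gives the pointwise
    hypothesis for the projections to the first axis, and then on these projections, which
    elimination describes by linear inequalities. *)
Lemma euler_relation2 (I : finType) (c : I -> int) (q : I -> seq (R * R * R)) :
  (forall x y, \sum_(i | halfplanes (q i) x y) c i = 0) ->
  \sum_(i | `[< exists x y, halfplanes (q i) x y >]) c i = 0.
Proof.
move=> c0.
rewrite -[RHS](@euler_relation1 I c (eliminate \o q)).
  apply: eq_bigl => i /=; apply: asbool_equiv_eq.
  split=> -[x Hx]; last by move: Hx; rewrite eliminateP => /asboolP[y ?]; exists x, y.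
  by exists x; rewrite eliminateP; apply/asboolP.
move=> x.
pose slice i := [seq (d.1.2, d.2 - d.1.1 * x) | d <- q i].
have sliceE i y : halflines (slice i) y = halfplanes (q i) x y.
  by rewrite /halflines all_map; apply: eq_all => d /=; rewrite lerBrDl.
rewrite -[RHS](@euler_relation1 I c slice).
  apply: eq_bigl => i /=; rewrite eliminateP; apply: asbool_equiv_eq.
  by split=> -[y Hy]; exists y; [rewrite sliceE|rewrite -sliceE].
by move=> y; rewrite -[RHS](c0 x y); apply: eq_bigl => i; rewrite sliceE.
Qed.

End EulerRelation.

(** * Signed counts of initial segments up to ties *)

Lemma sum_sign_interval (T : finType) (A C : {set T}) : A \subset C ->
  \sum_(P : {set T} | (A \subset P) && (P \subset C)) (-1) ^+ #|P|
    = (-1) ^+ #|A| * (A == C)%:R :> int.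
Proof.
move=> sAC.
(* [F] is the weight of an element put into [P], [G] that of an element left out. The sum factors
   over the elements, and each element of [C] outside [A] gives the factor -1 + 1 = 0. *)
pose F i : int := if i \in C then -1 else 0.
pose G i : int := if i \in A then 0 else 1.
transitivity (\prod_x (F x + G x)).
  rewrite bigA_distr big_mkcond /=; apply: eq_bigr => P _.
  case: ifP => [/andP[AP PC]|/negbT]; last first.
    rewrite negb_and => /orP[/subsetPn[x xA xP]|/subsetPn[x xP xC]].
      by rewrite (bigD1 x) //= (negPf xP) /G xA mul0r.
    by rewrite (bigD1 x) //= xP /F (negPf xC) mul0r.
  rewrite (bigID [in P]) /= [X in _ * X]big1 ?mulr1; last first.
    by move=> x xP; rewrite (negPf xP) /G (contraNF (subsetP AP x) xP).
  by rewrite -prodr_const; apply: eq_bigr => x xP; rewrite xP /F (subsetP PC).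
rewrite (bigID [in A]) /= (eq_bigr (fun=> -1)) => [|x xA]; last first.
  by rewrite /F /G xA (subsetP sAC) // addr0.
rewrite prodr_const; congr (_ * _); have [AC|neqAC] := eqVneq A C.
  by rewrite big1 // => x xA; rewrite /F /G -AC (negPf xA) add0r.
have /subsetPn[x xC xA] : ~~ (C \subset A).
  by apply: contra neqAC => sCA; rewrite eqEsubset sAC.
by rewrite (bigD1 x) //= /F /G xC (negPf xA) addNr mul0r.
Qed.

Section TieCounting.
Variables (T : finType) (R : realDomainType) (d : T -> R).
Implicit Types D e P : {set T}.

(* Taking x and y in e, which lies in both index sets when e is disjoint from P,
   this forces d to be constant on e: e is a tie and P is cut off just at it. *)
Definition squeezed D e P :=
  [forall x in P :|: e, forall y in D :\: P, d x <= d y].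

Lemma squeezedP D e P :
  reflect (forall x y, x \in P :|: e -> y \in D :\: P -> d x <= d y) (squeezed D e P).
Proof.
apply: (iffP forall_inP) => [H x y xP yD|H x xP]; first exact: (forall_inP (H x xP)).
by apply/forall_inP => y yD; exact: H.
Qed.

(** For [e = set0] the sum runs over the initial segments of [D], where a tie may be cut anywhere.
    For a pair [e] it runs over those [P] that cut [D] at the level of [e] and leave [e] out. *)
Definition tie_sum D e : int :=
  \sum_(P : {set T} | (P \subset D :\: e) && squeezed D e P) (-1) ^+ #|P|.

(** * Removal of the top tie class [M] *)

Section RemoveTop.
Variables (D : {set T}) (z : T).
Hypotheses (zD : z \in D) (zmax : {in D, forall x, d x <= d z}).
Let M := [set x in D | d x == d z].
Let D' := D :\: M.

Let D'_lt x : x \in D' -> d x < d z.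
Proof.
rewrite !inE andbC => /andP[xD]; rewrite xD /= => xz.
by rewrite lt_neqAle xz zmax.
Qed.

Let sub_D'D : D' \subset D. Proof. exact: subsetDl. Qed.

Let M_eq x : x \in M -> d x = d z.
Proof. by rewrite inE => /andP[_ /eqP]. Qed.

Let in_DP x : x \in D -> (x \in D') || (x \in M).
Proof. by move=> xD; rewrite !inE xD /= andbT orNb. Qed.

Lemma squeezed_below e P : e \subset D' -> P \subset D' ->
  squeezed D e P = squeezed D' e P.
Proof.
move=> eD' PD'; apply/squeezedP/squeezedP => H x y xPe; rewrite inE => /andP[yP yD].
  by apply: H => //; rewrite inE yP (subsetP sub_D'D).
case/orP: (in_DP yD) => [yD'|/M_eq->]; first by apply: H; rewrite // inE yP.
apply/ltW/D'_lt; move: xPe; rewrite inE => /orP[/(subsetP PD')|/(subsetP eD')] //.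
Qed.

(** An element of [P :|: e] with the top value forces every element of [D] outside [P] up to that
    value. *)
Lemma squeezed_meets_top e P : squeezed D e P -> ~~ (P :|: e \subset D') ->
  P :|: e \subset D -> D' \subset P.
Proof.
move=> /squeezedP H /subsetPn[x xPe xD'] PeD.
have /M_eq xz : x \in M by have := in_DP (subsetP PeD _ xPe); rewrite (negPf xD').
apply/subsetP => y yD'; apply: contraLR (D'_lt yD') => yP.
by rewrite -leNgt -xz; apply: H; rewrite // inE yP (subsetP sub_D'D).
Qed.

Lemma squeezed_above e P : e \subset M -> D' \subset P -> P \subset D -> squeezed D e P.
Proof.
move=> eM D'P PD; apply/squeezedP => x y xPe; rewrite inE => /andP[yP yD].
have -> : d y = d z.
  apply: M_eq; case/orP: (in_DP yD) => // /(subsetP D'P); by rewrite (negPf yP).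
apply: zmax; move: xPe; rewrite inE => /orP[/(subsetP PD)//|/(subsetP eM)].
by rewrite inE => /andP[].
Qed.

(** A set [P] that reaches into [M] would have to contain all of [D'], hence [e], which it must
    avoid. *)
Lemma tie_sum_below e : e \subset D' -> e != set0 -> tie_sum D e = tie_sum D' e.
Proof.
move=> eD' /set0Pn[x xe]; apply: eq_bigl => P.
apply/andP/andP => -[PD sq]; last first.
  have PD' : P \subset D' by apply: subset_trans PD _; exact: subsetDl.
  split; last by rewrite squeezed_below.
  by apply: subset_trans PD _; exact: setSD.
have PD' : P \subset D'.
  have PD0 : P \subset D by apply: subset_trans PD _; exact: subsetDl.
  case: (boolP (P :|: e \subset D')); first by rewrite subUset => /andP[].
  move=> /(squeezed_meets_top sq); rewrite subUset PD0 (subset_trans eD') // => /(_ isT) D'P.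
  have xP := subsetP D'P _ (subsetP eD' _ xe).
  by have := subsetP PD _ xP; rewrite inE xe.
rewrite -squeezed_below //; split=> //; apply/subsetP => y yP; rewrite inE (subsetP PD') // andbT.
by have := subsetP PD _ yP; rewrite inE => /andP[].
Qed.

(** Since [e] meets [M], every admissible [P] contains [D']; as [P] avoids [e], this forces [e] into
    [M]. Then [P] runs through the whole interval from [D'] to [D :\: e], whose signed sum vanishes
    unless it is a single set, that is, unless [e = M]. *)
Lemma tie_sum_top e : e \subset D -> ~~ (e \subset D') ->
  tie_sum D e = (-1) ^+ #|D'| * (e == M)%:R.
Proof.
move=> eD neD'.
have D'P P : P \subset D :\: e -> squeezed D e P -> D' \subset P.
  move=> PD sq; apply: squeezed_meets_top sq _ _.
    by apply: contra neD'; rewrite subUset => /andP[].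
  by rewrite subUset eD (subset_trans PD) // subsetDl.
case: (boolP (e \subset M)) => [eM|neM]; last first.
  have -> : (e == M) = false by apply: contraNF neM => /eqP->.
  rewrite mulr0 /tie_sum big_pred0 // => P; apply/negP => /andP[PD sq].
  case/subsetPn: neM => x xe xM; have := in_DP (subsetP eD _ xe); rewrite (negPf xM) orbF.
  by move=> /(subsetP (D'P _ PD sq)) /(subsetP PD); rewrite inE xe.
have -> : (e == M) = (D' == D :\: e).
  apply/eqP/eqP => [->//|/setP E]; apply/setP => x; have := E x.
  rewrite !in_setD [x \in M]inE; case xD: (x \in D); rewrite ?andbT /=.
    by move/negb_inj.
  by move=> _; apply: contraFF xD => /(subsetP eD).
rewrite -sum_sign_interval; last by apply: setDS.
apply: eq_bigl => P; apply/andP/andP => -[]; first by move=> PD sq; rewrite (D'P P).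
by move=> D'P' PD; split=> //; apply: squeezed_above => //; apply: subset_trans PD _; exact: subsetDl.
Qed.

(** The segments not inside [D'] are the sets strictly between [D'] and [D], together with [D]. With
    [D'] added they form a full interval of signed sum 0, so alone they contribute minus the sign of
    [D']. *)
Lemma tie_sum_set0 : tie_sum D set0 = tie_sum D' set0 - (-1) ^+ #|D'|.
Proof.
rewrite /tie_sum !setD0 (bigID (fun P => P \subset D')) /=; congr (_ + _).
  apply: eq_bigl => P; case PD': (P \subset D'); rewrite ?andbT ?andbF //=.
  by rewrite (subset_trans PD') //= squeezed_below // sub0set.
apply: (addrI ((-1) ^+ #|D'|)); rewrite subrr.
have nD : (D' == D) = false.
  by apply/eqP => E; move: zD; rewrite -E !inE zD eqxx.
have := sum_sign_interval sub_D'D; rewrite nD mulr0 => E; rewrite -[RHS]E.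
rewrite [RHS](bigD1 D') /= ?subxx ?sub_D'D //; congr (_ + _); apply: eq_bigl => P.
apply/andP/andP => [[/andP[PD sq] nPD']|[/andP[D'P PD] PnD']]; last first.
  rewrite PD squeezed_above ?sub0set //; split=> //; apply: contra PnD' => PD'.
  by rewrite eqEsubset PD'.
have D'P : D' \subset P.
  by apply: squeezed_meets_top sq _ _; rewrite setU0.
by rewrite D'P PD; split=> //; apply: contra nPD' => /eqP->.
Qed.

End RemoveTop.

(** Induction on [D], removing the top class [M]. The empty set contributes minus the sign of
    [D :\: M], and among the pairs that meet [M] only [e = M] contributes, with the opposite sign.
    So the left side is unchanged when [M] has two elements and switches between 0 and 1 when it has
    one or three, as the parity of the size of [D] does. *)
Lemma tie_sum_parity D :
  (forall e, e \subset D -> (forall x y, x \in e -> y \in e -> d x = d y) -> (#|e| <= 3)%N) ->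
  tie_sum D set0 + \sum_(e : {set T} | (e \subset D) && (#|e| == 2)) tie_sum D e
    = (~~ odd #|D|)%:R.
Proof.
have [n] := ubnP #|D|; elim: n D => // n IH D /ltnSE leDn ties.
have [->|/set0Pn[z0 z0D]] := eqVneq D set0.
  rewrite cards0 big_pred0; last first.
    by move=> e; rewrite subset0; case: eqP => // ->; rewrite cards0.
  rewrite addr0 /tie_sum (big_pred1 set0) ?cards0 // => P /=.
  rewrite setD0 subset0; case: eqP => //= ->.
  by apply/squeezedP => x y; rewrite !inE.
have [z zD zmax] : exists2 z, z \in D & {in D, forall x, d x <= d z}.
  have := @Order.TotalTheory.arg_maxP _ R T z0 [in D] d z0D.
  by case=> z zD zmax; exists z.
pose M := [set x in D | d x == d z].
have MD : M \subset D by apply/subsetP => x; rewrite inE => /andP[].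
have zM : z \in M by rewrite inE zD eqxx.
have cardD : #|D| = (#|M| + #|D :\: M|)%N by rewrite cardsD (setIidPr MD) subnKC // subset_leq_card.
have M_gt0 : (0 < #|M|)%N by apply/card_gt0P; exists z.
have M_le3 : (#|M| <= 3)%N.
  by apply: ties => // x y; rewrite !inE => /andP[_ /eqP->] /andP[_ /eqP->].
have {}IH := IH (D :\: M); rewrite (tie_sum_set0 zD) // -/M.
have -> : \sum_(e : {set T} | (e \subset D) && (#|e| == 2)) tie_sum D e =
    \sum_(e : {set T} | (e \subset D :\: M) && (#|e| == 2)) tie_sum (D :\: M) e
      + (-1) ^+ #|D :\: M| * (#|M| == 2)%:R.
  rewrite (bigID (fun e => e \subset D :\: M)) /=; congr (_ + _).
    apply: eq_big => [e|e].
      case: (boolP (e \subset D :\: M)) => [eD'|]; rewrite ?andbT ?andbF //.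
      by rewrite (subset_trans eD') ?subsetDl.
    move=> /andP[/andP[eD /eqP e2] eD']; rewrite -(tie_sum_below zmax) //.
    by rewrite -card_gt0 e2.
  rewrite (eq_bigr (fun e => (-1) ^+ #|D :\: M| * (e == M)%:R)); last first.
    by move=> e /andP[/andP[eD _] eD']; rewrite -tie_sum_top.
  rewrite -big_distrr /=; congr (_ * _).
  have nMD : ~~ (M \subset D :\: M) by apply/subsetPn; exists z; rewrite // inE zM.
  have [M2|M2] := eqVneq #|M| 2.
    rewrite (bigD1 M) ?MD ?M2 ?nMD //= eqxx big1 ?addr0 // => e /andP[_ /negPf->] //.
  by rewrite big1 // => e /andP[/andP[_ /eqP e2] _]; case: eqP => // E; rewrite -E e2 in M2.
have {IH} : tie_sum (D :\: M) set0 +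
    \sum_(e : {set T} | (e \subset D :\: M) && (#|e| == 2)) tie_sum (D :\: M) e
    = (~~ odd #|D :\: M|)%:R.
  apply: IH; first by rewrite cardD in leDn; apply: leq_trans leDn; rewrite -addn1 addnC leq_add2r.
  by move=> e eD'; apply: ties; apply: subset_trans eD' _; exact: subsetDl.
set a := tie_sum _ _; set b := \sum_(_ | _) _ => ab.
have -> : a - (-1) ^+ #|D :\: M| + (b + (-1) ^+ #|D :\: M| * (#|M| == 2)%:R)
   = (a + b) - (-1) ^+ #|D :\: M| * (1 - (#|M| == 2)%:R) by ring.
rewrite ab cardD oddD -signr_odd.
by case: #|M| M_gt0 M_le3 => [|[|[|[|m]]]] //= _ _; case: (odd _).
Qed.

(** In the parity formula each pair contributes 0, since a squeezed pair is a tie. *)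
Lemma tie_sum_injective D : {in D &, injective d} ->
  tie_sum D set0 = (~~ odd #|D|)%:R.
Proof.
move=> dI; rewrite -tie_sum_parity ?[X in _ + X]big1 ?addr0 //.
  move=> e /andP[eD /cards2P[x [y [xy eE]]]]; rewrite /tie_sum big_pred0 // => P.
  apply/negP => /andP[PD /squeezedP sq].
  have xe : x \in e by rewrite eE !inE eqxx.
  have ye : y \in e by rewrite eE !inE eqxx orbT.
  have DP t : t \in e -> t \in D :\: P.
    move=> te; rewrite inE (subsetP eD) // andbT.
    by apply/negP => /(subsetP PD); rewrite inE te.
  case/eqP: xy; apply: dI; rewrite ?(subsetP eD) //.
  by apply: le_anti; rewrite !sq ?DP // inE ?xe ?ye orbT.
move=> e eD ec; apply: (@leq_trans 1) => //; rewrite leqNgt; apply/negP.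
case/card_gt1P => x [y [xe ye]] /eqP[]; apply: dI; rewrite ?(subsetP eD) //; exact: ec.
Qed.

End TieCounting.

(** * The pieces of a single bisector *)

Lemma sign_card (T : finType) (A : {set T}) :
  (-1) ^+ #|A| = \prod_x (-1) ^+ (x \in A) :> int.
Proof.
rewrite -prodr_const big_mkcond; apply: eq_bigr => x _.
by case: (x \in A).
Qed.

Section PlanarPoints.
Variables (T : finType) (R : realFieldType) (u v : T -> R).

Definition sqdist a b z := (u z - a) ^+ 2 + (v z - b) ^+ 2.

Hypothesis uv_inj : forall x y, u x = u y -> v x = v y -> x = y.
Hypothesis no_collinear : forall (a b c : R) (e : {set T}), (a, b) <> (0, 0) ->
  (forall z, z \in e -> a * u z + b * v z = c) -> (#|e| <= 2)%N.
Hypothesis no_cocircular : forall (a b r : R) (e : {set T}),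
  (forall z, z \in e -> sqdist a b z = r) -> (#|e| <= 3)%N.
Hypothesis oddT : odd #|T|.

Section Bisector.
Variables x y : T.
Hypothesis neq_xy : x != y.

Let e := [set x; y].
Let w1 := u y - u x.
Let w2 := v y - v x.
(* The point of parameter t on the bisector of x and y. *)
Let a t := (u x + u y) / 2 - t * w2.
Let b t := (v x + v y) / 2 + t * w1.
(** Along the bisector the squared distance to [z] minus that to [x] is affine in [t]. Its slope is
    [slope z] and its zero [root z], the parameter of the circumcentre of [x], [y], [z]. *)
Let slope z := 2 * (w2 * (u z - u x) - w1 * (v z - v x)).
Let root z := ((u z - u x) * (u x + u y) + (v z - v x) * (v x + v y)
   - (u z ^+ 2 + v z ^+ 2 - u x ^+ 2 - v x ^+ 2)) / slope z.

Let w_neq0 : (w2, - w1) <> (0, 0).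
Proof.
move=> E; have /= E1 := congr1 fst E; have /= E2 := congr1 snd E.
move/eqP: neq_xy; apply; apply/esym/uv_inj; apply/eqP; rewrite -subr_eq0; apply/eqP=> //.
by rewrite -[RHS]oppr0 -E2 opprK.
Qed.

(** A zero slope would put [z] on the line through [x] and [y]. *)
Let slope_neq0 z : z \notin e -> slope z != 0.
Proof.
move=> ze; apply/negP; rewrite mulf_eq0 pnatr_eq0 /= => /eqP sz.
suff: (#|z |: e| <= 2)%N by rewrite cardsU1 ze cards2 neq_xy.
apply: (no_collinear (c := w2 * u x - w1 * v x) w_neq0) => t; rewrite !inE => /or3P[] /eqP->.
- by apply/eqP; rewrite -subr_eq0 -sz; apply/eqP; ring.
- ring.
- rewrite /w1 /w2; ring.
Qed.

Let sqdist_root z t : z \notin e ->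
  sqdist (a t) (b t) z - sqdist (a t) (b t) x = slope z * (t - root z).
Proof.
move=> ze; have s0 := slope_neq0 ze.
by rewrite mulrBr /root mulrCA mulfV // mulr1 /sqdist /a /b /slope /w1 /w2; field.
Qed.

Let sqdist_xy t : sqdist (a t) (b t) x = sqdist (a t) (b t) y.
Proof. by rewrite /sqdist /a /b /w1 /w2; field. Qed.

Let bisector_param a' b' : sqdist a' b' x = sqdist a' b' y ->
  exists t, a' = a t /\ b' = b t.
Proof.
move=> dxy; have perp : (a' - (u x + u y) / 2) * w1 + (b' - (v x + v y) / 2) * w2 = 0.
  suff -> : (a' - (u x + u y) / 2) * w1 + (b' - (v x + v y) / 2) * w2
     = (sqdist a' b' x - sqdist a' b' y) / 2 by rewrite dxy subrr mul0r.
  by rewrite /sqdist /w1 /w2; field.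
have n0 : w1 ^+ 2 + w2 ^+ 2 != 0.
  rewrite paddr_eq0 ?sqr_ge0 // !sqrf_eq0; apply/negP => /andP[/eqP E1 /eqP E2].
  by apply: w_neq0; rewrite E1 E2 oppr0.
(* The vector from the midpoint of [x] and [y] to the given point is projected onto the direction
   [(- w2, w1)] of the bisector. *)
exists (((b' - (v x + v y) / 2) * w1 - (a' - (u x + u y) / 2) * w2) / (w1 ^+ 2 + w2 ^+ 2)).
rewrite /a /b; move: perp n0.
set p := (u x + u y) / 2; set p' := (v x + v y) / 2.
set s := _ * w1 - _ * w2; set n := w1 ^+ 2 + _ => perp n0.
have Ha : s * w2 = (p - a') * n.
  apply/eqP; rewrite -subr_eq0 -[X in _ == X](mulr0 w1) -perp; apply/eqP.
  by rewrite /s /n; ring.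
have Hb : s * w1 = (b' - p') * n.
  apply/eqP; rewrite -subr_eq0 -[X in _ == X](mulr0 (- w2)) -perp; apply/eqP.
  by rewrite /s /n; ring.
by split; rewrite mulrAC ?Ha ?Hb mulfK //; ring.
Qed.

(** Equal roots would make [z], [w], [x], [y] lie on one circle. *)
Let root_inj : {in ~: e &, injective root}.
Proof.
move=> z w; rewrite !in_setC => ze we rzw; apply/eqP/negPn/negP => neq_zw.
pose t := root z.
have dz : sqdist (a t) (b t) z = sqdist (a t) (b t) x.
  by apply/eqP; rewrite -subr_eq0 sqdist_root // subrr mulr0.
have dw : sqdist (a t) (b t) w = sqdist (a t) (b t) x.
  by apply/eqP; rewrite -subr_eq0 sqdist_root // /t rzw subrr mulr0.
suff: (#|z |: (w |: e)| <= 3)%N.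
  by rewrite 2!cardsU1 we cards2 neq_xy in_setU1 negb_or neq_zw ze.
apply: (no_cocircular (a := a t) (b := b t) (r := sqdist (a t) (b t) x)) => s.
by rewrite !inE => /or4P[] /eqP-> //; rewrite sqdist_xy.
Qed.

(* Exchanging the two sides of the points whose slope is positive makes
   all the constraints on t point the same way. *)
Let flip (P : {set T}) : {set T} :=
  [set z | (z \in P) (+) ((z \notin e) && (0 < slope z))].

Let flipK : involutive flip.
Proof. by move=> P; apply/setP => z; rewrite !inE -addbA addbb addbF. Qed.

Let flip_sub (P : {set T}) : (flip P \subset ~: e) = (P \subset ~: e).
Proof.
suff H (Q : {set T}) : Q \subset ~: e -> flip Q \subset ~: e.
  by apply/idP/idP => [/H|/H //]; rewrite flipK.
move=> /subsetP Qe; apply/subsetP => z; rewrite in_setC inE => zQ; apply/negP => ze.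
by move: zQ; rewrite ze /= addbF => /Qe; rewrite inE ze.
Qed.

(** After the flip, the piece belonging to [P] is the set of all [t] at or after the roots of
    [flip P] and at or before all other roots. It is nonempty exactly when [flip P] is an initial
    segment for the order of the roots. *)
Let squeezed_flip (P : {set T}) : P \subset ~: e ->
  `[< exists a b, squeezed (sqdist a b) setT e P >]
    = squeezed root (~: e) set0 (flip P).
Proof.
move=> Pe.
have xe : x \in e by rewrite !inE eqxx.
have ye : y \in e by rewrite !inE eqxx orbT.
have eP z : z \in e -> z \in setT :\: P.
  by move=> ze; rewrite !inE andbT; apply/negP => /(subsetP Pe); rewrite inE ze.
have side z t : z \notin e ->
    (if z \in P then sqdist (a t) (b t) z <= sqdist (a t) (b t) x
     else sqdist (a t) (b t) x <= sqdist (a t) (b t) z)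
    = (if z \in flip P then root z <= t else t <= root z).
  move=> ze; rewrite -[X in if _ then X else _]subr_le0 -[X in if _ then _ else X]subr_ge0.
  rewrite sqdist_root // inE ze /=; have := slope_neq0 ze.
  case: (ltgtP (slope z) 0) => // s0 _; case: (z \in P) => /=.
  - by rewrite nmulr_rle0 // subr_ge0.
  - by rewrite nmulr_rge0 // subr_le0.
  - by rewrite pmulr_rle0 // subr_le0.
  - by rewrite pmulr_rge0 // subr_ge0.
apply/asboolP/squeezedP => [[a' [b' /squeezedP sq]]|sq].
  (* Both [x] and [y] lie in [e] and outside [P], so each is at most as far as the other and the
     point is on the bisector. *)
  have [|t [? ?]] := @bisector_param a' b'.
    by apply: le_anti; rewrite !sq ?eP // in_setU ?xe ?ye orbT.
  subst a' b'.
  have sd z : z \notin e -> if z \in flip P then root z <= t else t <= root z.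
    move=> ze; rewrite -side //; case: ifP => zP; apply: sq.
    - by rewrite in_setU zP.
    - exact: eP.
    - by rewrite in_setU xe orbT.
    - by rewrite in_setD in_setT zP.
  move=> z z'; rewrite setU0 in_setD => zf /andP[zf' ze'].
  have ze : z \notin e.
    by rewrite -in_setC; apply: (subsetP _ _ zf); rewrite flip_sub.
  have := sd z ze; rewrite zf => /le_trans; apply.
  by have := sd z' _; rewrite (negPf zf'); apply; rewrite -in_setC.
have [|t [Lt tU]] := @exists_between R
    [seq root z | z in flip P] [seq root z | z in ~: e :\: flip P].
  by move=> _ _ /imageP[z zf ->] /imageP[z' zf' ->]; apply: sq; rewrite ?setU0.
exists (a t), (b t).
have sd z : z \notin e -> if z \in P then sqdist (a t) (b t) z <= sqdist (a t) (b t) x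
     else sqdist (a t) (b t) x <= sqdist (a t) (b t) z.
  move=> ze; rewrite side //; case: ifP => zf; first by rewrite Lt // image_f.
  by rewrite tU // image_f // in_setD zf in_setC.
have dxe z : z \in e -> sqdist (a t) (b t) z = sqdist (a t) (b t) x.
  by rewrite !inE => /orP[] /eqP-> //; rewrite sqdist_xy.
have dP z : z \in P :|: e -> sqdist (a t) (b t) z <= sqdist (a t) (b t) x.
  rewrite in_setU; case: (boolP (z \in e)) => [/dxe->//|ze]; rewrite orbF => zP.
  by have := sd z ze; rewrite zP.
have dnP z : z \in setT :\: P -> sqdist (a t) (b t) x <= sqdist (a t) (b t) z.
  case: (boolP (z \in e)) => [/dxe->//|ze]; rewrite in_setD in_setT andbT => /negPf zP.
  by have := sd z ze; rewrite zP.
by apply/squeezedP => z z' /dP + /dnP; exact: le_trans.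
Qed.

(** The flip multiplies all signs by the common factor [(-1) ^+ #|N|]. What remains is the signed
    count of initial segments of n - 2 points with distinct roots, which is 0 because n - 2 is
    odd. *)
Lemma bisector_sum :
  \sum_(P : {set T} | (P \subset setT :\: e) && `[< exists a b, squeezed (sqdist a b) setT e P >])
    (-1) ^+ #|P| = 0 :> int.
Proof.
rewrite setTD.
transitivity (\sum_(P : {set T} |
    (P \subset ~: e) && squeezed root (~: e) set0 (flip P)) (-1) ^+ #|P| : int).
  by apply: eq_bigl => P; case: (boolP (P \subset ~: e)) => //= Pe; rewrite squeezed_flip.
rewrite (reindex_inj (inv_inj flipK)) /=.
pose N := [set z | (z \notin e) && (0 < slope z)].
transitivity ((-1) ^+ #|N| * tie_sum root (~: e) set0).
  rewrite /tie_sum big_distrr setD0; apply: eq_big => [P|P _]; first by rewrite flip_sub flipK.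
  rewrite !sign_card /= -big_split /=; apply: eq_bigr => z _.
  by rewrite !inE signr_addb mulrC.
have : (#|e| + #|~: e|)%N = #|T| by rewrite cardsC.
rewrite tie_sum_injective // cards2 neq_xy => cardT.
by move: oddT; rewrite -cardT oddD => /= ->; rewrite mulr0.
Qed.

End Bisector.

(** * Euler's relation for all cells and bisector pieces together *)

Let half (e P : {set T}) : seq (R * R * R) :=
  [seq (2 * (u z.2 - u z.1), 2 * (v z.2 - v z.1),
        (u z.2 ^+ 2 + v z.2 ^+ 2) - (u z.1 ^+ 2 + v z.1 ^+ 2))
  | z <- enum (setX (P :|: e) (setT :\: P))].

(** The quadratic terms in [a] and [b] cancel, so comparing the squared distances to two points is a
    linear condition. *)
Let halfE (e P : {set T}) a b : halfplanes (half e P) a b = squeezed (sqdist a b) setT e P.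
Proof.
have E z z' : (2 * (u z' - u z) * a + 2 * (v z' - v z) * b <=
    u z' ^+ 2 + v z' ^+ 2 - (u z ^+ 2 + v z ^+ 2)) = (sqdist a b z <= sqdist a b z').
  by rewrite -[LHS]subr_ge0 -[RHS]subr_ge0; congr (0 <= _); rewrite /sqdist; ring.
rewrite /halfplanes all_map; apply/allP/squeezedP => [H z z' zP zP'|H [z z']].
  by rewrite -E; apply: (H (z, z')); rewrite mem_enum in_setX zP.
by rewrite mem_enum in_setX => /andP[zP zP'] /=; rewrite E; exact: H.
Qed.

Lemma separable_sets_alternate :
  \sum_(A : {set T} | `[< exists a b, squeezed (sqdist a b) setT set0 A >]) (-1) ^+ #|A| = 0 :> int.
Proof.
(* Cells are indexed by [e = set0] and bisector pieces by pairs [e]; the coefficient 0 discards all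
   other indices. *)
pose c (i : {set T} * {set T}) : int :=
  if ((i.1 == set0) || (#|i.1| == 2)) && (i.2 \subset setT :\: i.1) then (-1) ^+ #|i.2| else 0.
have splitE (Q : {set T} -> {set T} -> bool) : \sum_(i | Q i.1 i.2) c i =
    \sum_(P : {set T} | (P \subset setT :\: set0) && Q set0 P) (-1) ^+ #|P| +
    \sum_(e : {set T} | (e \subset setT) && (#|e| == 2))
      \sum_(P : {set T} | (P \subset setT :\: e) && Q e P) (-1) ^+ #|P|.
  have inner (e : {set T}) : (e == set0) || (#|e| == 2) ->
      \sum_(P : {set T} | Q e P) c (e, P) =
      \sum_(P : {set T} | (P \subset setT :\: e) && Q e P) (-1) ^+ #|P|.
    move=> e02; rewrite [RHS]big_mkcondl /=; apply: eq_bigr => P _.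
    by rewrite /c /= e02.
  rewrite -(pair_big_dep xpredT Q (fun e P => c (e, P))) /= (bigD1 set0) //= inner ?eqxx //.
  congr (_ + _).
  rewrite (bigID (fun e : {set T} => #|e| == 2)) /= [X in _ + X]big1 ?addr0; last first.
    by move=> e /andP[/negPf e0 /negPf e2]; rewrite big1 // => P _; rewrite /c /= e0 e2.
  apply: eq_big => [e|e /andP[_ e2]]; last by rewrite inner // e2 orbT.
  by rewrite subsetT; case: eqP => //= ->; rewrite cards0.
have := @euler_relation2 R _ c (fun i => half i.1 i.2).
rewrite (splitE (fun e P => `[< exists a b, halfplanes (half e P) a b >])) => euler.
have existsE e P : `[< exists a b, halfplanes (half e P) a b >] =
    `[< exists a b, squeezed (sqdist a b) setT e P >].
  by apply: asbool_equiv_eq; split=> -[a [b Hab]]; exists a, b; rewrite halfE in Hab *.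
rewrite -[RHS]euler => [|a b]; last first.
  rewrite (splitE (fun e P => halfplanes (half e P) a b)).
  under eq_bigl do rewrite halfE.
  under [X in _ + X]eq_bigr do under eq_bigl do rewrite halfE.
  (* At each point the cells and pieces sum to 0, because ties have at most three elements and the
     number of points is odd. *)
  rewrite (tie_sum_parity (d := sqdist a b)) ?cardsT ?oddT // => e _ ec.
  have [->|[z ze]] := set_0Vmem e; first by rewrite cards0.
  by apply: (no_cocircular (a := a) (b := b) (r := sqdist a b z)) => t te; exact: ec.
rewrite [X in _ = _ + X]big1 => [|e /andP[_ /cards2P[x [y [xy ->]]]]].
  by rewrite addr0; apply: eq_bigl => A; rewrite setD0 subsetT existsE.
by under eq_bigl do rewrite existsE; exact: bisector_sum.
Qed.

End PlanarPoints.

(** * Transfer to Voronoi cells of finite sets in the plane *)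

Lemma ord2E (i : 'I_2) : i = 0 \/ i = 1.
Proof. by case: i => [[|[|//]] i2]; [left|right]; apply: val_inj. Qed.

Section VoronoiCells.
Variables (R : realType) (S : {fset 'rV[R]_2}).

Let u (z : S) := val z 0 0.
Let v (z : S) := val z 0 1.

Let rv a b : 'rV[R]_2 := \row_(i < 2) if i == 0 then a else b.

Let eucl_distE (z : S) (p : 'rV[R]_2) :
  eucl_dist (val z) p = Num.sqrt (sqdist u v (p 0 0) (p 0 1) z).
Proof.
rewrite /eucl_dist /sqdist /u /v !big_ord_recl big_ord0 addr0.
by rewrite (_ : lift ord0 ord0 = 1) //; exact: val_inj.
Qed.

Let eucl_distC (p q : 'rV[R]_2) : eucl_dist p q = eucl_dist q p.
Proof.
rewrite /eucl_dist; congr Num.sqrt; apply: eq_bigr => i _.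
by rewrite -sqrrN opprB.
Qed.

Let sqdist_ge0 a b z : 0 <= sqdist u v a b z.
Proof. by rewrite addr_ge0 ?sqr_ge0. Qed.

Let voronoi_cell_nonempty (A : {set S}) :
  `[< voronoi_cell S [fset val z | z in A]%fset !=set0 >]%classic
    = `[< exists a b, squeezed (sqdist u v a b) setT set0 A >].
Proof.
have vA (z : S) : (val z \in [fset val z | z in A]%fset) = (z \in A).
  apply/imfsetP/idP => [[z' z'A /val_inj->]//|zA]; by exists z.
apply: asbool_equiv_eq; split=> [[p Hp]|[a [b /squeezedP sq]]].
  exists (p 0 0), (p 0 1); apply/squeezedP => x y; rewrite setU0 in_setD in_setT andbT => xA yA.
  have := Hp (val x) _ (val y) _; rewrite /= !eucl_distE ler_sqrt ?sqdist_ge0 //.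
  by apply; rewrite ?vA // in_fsetD vA yA (valP y).
exists (rv a b) => x /imfsetP[z zA ->] y /=; rewrite in_fsetD => /andP[yA yS].
have := vA [` yS]%fset; rewrite /= => vy; rewrite vy in yA.
have -> : y = val [` yS]%fset by [].
rewrite !eucl_distE ler_sqrt ?sqdist_ge0 //.
by rewrite !mxE /=; apply: sq; rewrite ?setU0 // in_setD yA in_setT.
Qed.

Lemma num_voronoi_cellsE k : num_voronoi_cells S k =
  #|[set A : {set S} | `[< exists a b, squeezed (sqdist u v a b) setT set0 A >] & #|A| == k]|.
Proof.
rewrite /num_voronoi_cells.
pose g (A : {set S}) := [fset val z | z in A]%fset.
have gI : injective g.
  move=> A B /fsetP gAB; apply/setP => z; have := gAB (val z).
  by rewrite !mem_imfset //; exact: val_inj.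
transitivity (#|` [fset g A | A in [set A : {set S} |
    `[< exists a b, squeezed (sqdist u v a b) setT set0 A >] & #|A| == k]]|%fset).
  congr (#|` _|)%fset; apply/fsetP => B; rewrite finmap.inE /= finmap.inE /= fpowersetE.
  have cardg A : #|` g A|%fset = #|A| by rewrite card_imfset -?cardE //; exact: val_inj.
  apply/and3P/imfsetP => [[BS Bk QB]|[A + ->]].
    have gB : B = g [set z | val z \in B].
      apply/fsetP => p; apply/idP/imfsetP => [pB|[z + ->]]; last by rewrite /= inE.
      by exists [` fsubsetP BS _ pB]%fset; rewrite /= ?inE.
    exists [set z | val z \in B] => //.
    by rewrite /= inE -voronoi_cell_nonempty -cardg -/(g _) -gB QB.
  rewrite /= inE -voronoi_cell_nonempty -cardg => /andP[QA Ak]; split=> //.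
  by apply/fsubsetP => _ /imfsetP[z _ ->]; exact: valP.
by rewrite card_imfset // -cardE.
Qed.

Lemma voronoi_alternate : general_position S -> odd #|` S| ->
  \sum_(A : {set S} | `[< exists a b, squeezed (sqdist u v a b) setT set0 A >])
    (-1) ^+ #|A| = 0 :> int.
Proof.
move=> [ncol ncoc] oddS.
(* General position speaks of exactly three or four points, so a larger subset is first cut down to
   that size. *)
have large_subset (e : {set S}) n : (n < #|e|)%N ->
    exists T : {fset 'rV[R]_2}, [/\ (T `<=` S)%fset, #|` T|%fset = n.+1 &
      forall p, p \in T -> exists2 z, z \in e & p = val z].
  move=> /card_geqP[s [us ss se]].
  exists [fset val z | z in s]%fset; split.
  - by apply/fsubsetP => _ /imfsetP[z _ ->]; exact: valP.
  - by rewrite card_imfset /= ?undup_id //; exact: val_inj.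
  - by move=> _ /imfsetP[z zs ->]; exists z; rewrite ?se.
apply: separable_sets_alternate.
- move=> x y uxy vxy; apply/val_inj/rowP => i.
  by case: (ord2E i) => ->.
- move=> a b c e ab He; rewrite leqNgt; apply/negP => /large_subset[T [TS T3 Te]].
  by apply: (ncol T TS T3); exists a, b, c; split=> // p /Te[z /He <- ->].
- move=> a b r e He; rewrite leqNgt; apply/negP => /large_subset[T [TS T4 Te]].
  apply: (ncoc T TS T4); exists (rv a b), (Num.sqrt r); split; last first.
    by move=> p /Te[z ze ->]; rewrite eucl_distC eucl_distE !mxE /= He.
  (* A circle must have positive radius. If [r <= 0], all points of [T] coincide with the centre,
     although [T] has four elements. *)
  rewrite sqrtr_gt0 ltNge; apply/negP => r0.
  have : (#|` T|%fset <= 1)%N.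
    apply: (@leq_trans #|` [fset rv a b]|%fset); last by rewrite cardfs1.
    apply: fsubset_leq_card; apply/fsubsetP => _ /Te[z ze ->].
    have dz := He z ze; rewrite in_fset1; apply/eqP/rowP => i; rewrite mxE.
    have /andP[/eqP uz /eqP vz] : (u z - a == 0) && (v z - b == 0).
      rewrite -(sqrf_eq0 (u z - a)) -(sqrf_eq0 (v z - b)) -paddr_eq0 ?sqr_ge0 //.
      rewrite -/(sqdist u v a b z).
      by rewrite eq_le sqdist_ge0 dz r0.
    move: uz vz => /eqP + /eqP; rewrite !subr_eq0 => /eqP uz /eqP vz.
    by case: (ord2E i) => ->.
  by rewrite T4.
- by rewrite -cardfE.
Qed.

End VoronoiCells.

(* Comparison of even and odd orders *)
Local Close Scope ring_scope.

Theorem theorem3p24 (R : realType) (S : {fset 'rV[R]_2}) (n : nat)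
    (S_gen : general_position S) (S_card : #|` S|%fset = n)
    (n_ge3 : 3 <= n) (n_odd : odd n) :
  \sum_(0 <= k < n.+1 | ~~ odd k) num_voronoi_cells S k =
  \sum_(0 <= k < n.+1 | odd k) num_voronoi_cells S k.
Proof.
pose Q (A : {set S}) := `[< exists a b, squeezed
  (sqdist (fun z : S => val z 0 0)%R (fun z : S => val z 0 1)%R a b) setT set0 A >].
(* The sets with nonempty cell are grouped by cardinality, so that summing the counts over the
   orders of one parity counts all such sets of that parity. *)
have sumE (b : bool) : \sum_(0 <= k < n.+1 | odd k == b) num_voronoi_cells S k
    = \sum_(A : {set S} | Q A && (odd #|A| == b)) 1.
  have cardA (A : {set S}) : #|A| < n.+1 by rewrite ltnS -S_card cardfE max_card.
  rewrite big_mkord (partition_big (fun A : {set S} => Ordinal (cardA A))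
    (fun k => odd k == b)) /=; last first.
    by move=> A /andP[].
  apply: eq_bigr => k kb; rewrite num_voronoi_cellsE -sum1_card; apply: eq_bigl => A.
  rewrite !inE -val_eqE /= -andbA; case: eqP => [->|_]; last by rewrite !andbF.
  by rewrite kb !andbT.
have := sumE true; have := sumE false.
under eq_bigl do rewrite eqbF_neg; move=> ->.
under eq_bigl do rewrite eqb_id; move=> ->.
have := voronoi_alternate S_gen; rewrite S_card => /(_ n_odd).
rewrite (bigID (fun A : {set S} => odd #|A|)) /= => /eqP.
rewrite (eq_bigr (fun=> (-1)%R)) => [|A /andP[_ oA]]; last by rewrite -signr_odd oA.
rewrite [X in (_ + X)%R](eq_bigr (fun=> 1%R)) => [|A /andP[_ oA]]; last first.
  by rewrite -signr_odd (negPf oA).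
rewrite sumrN addrC subr_eq0 => /eqP E.
apply/eqP; rewrite -(eqr_nat int) !natr_sum; apply/eqP.
by apply: etrans (etrans E _); apply: eq_bigl => A; rewrite ?eqbF_neg ?eqb_id.
Qed.
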